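(* Let $\varepsilon'\in(0,1)$, $\eta>0$, $R>0$ and $n,d\in\mathbb{N}$. If $X$ consists of $n$ points lying in the ball of radius $R$ around the origin in $\mathbb{R}^d$, then $$r^*(X,\eta,\varepsilon')\le 3\Big(6+\frac{53}{d}\eta R^2+\frac3d\log\frac{2n}{\varepsilon'}\Big)^d .$$
   Context: For $X=\{x_1,\dots,x_n\}$ with $\|x_i\|_2\le R$, let $K_{ij}=e^{-\eta\|x_i-x_j\|_2^2}$ with eigenvalues $\lambda_1(K)\ge\dots\ge\lambda_n(K)$. The effective dimension at level $\tau>0$ is $d_{\mathrm{eff}}(\tau)=\sum_{j=1}^n\frac{\lambda_j(K)}{\lambda_j(K)+\tau n}$, and the approximation rank is $r^*(X,\eta,\varepsilon')=d_{\mathrm{eff}}\big(\frac{\varepsilon'}{2n}e^{-4\eta R^2}\big)$. *)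

(* Defs.v *)
From mathcomp Require Import all_boot all_order all_algebra.
From mathcomp Require Import polyrcf.
From mathcomp Require Import all_classical all_reals all_analysis.

Set Implicit Arguments.
Unset Strict Implicit.
Unset Printing Implicit Defensive.

Import Order.TTheory GRing.Theory Num.Theory.

Local Open Scope ring_scope.

(* The canonical norm on ['rV[R]_d] is the sup norm, hence this definition. *)
Definition norm2 (R : realType) (d : nat) (v : 'rV[R]_d) : R :=
  Num.sqrt (\sum_(i < d) v 0 i ^+ 2).

(* All real eigenvalues, repeated according to their algebraic multiplicity
   and in nonincreasing order; [rootsR] lists each root only once. For a
   symmetric [A : 'M[R]_n] this sequence has size [n]. *)
Definition eigenvalues (R : realType) (n : nat) (A : 'M[R]_n) : seq R :=
  sort >=%R (flatten [seq nseq (mup x (char_poly A)) x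
                     | x <- rootsR (char_poly A)]).

(* [lambda A j], for [j < n], is the eigenvalue usually written with index
   [j + 1]. *)
Definition lambda (R : realType) (n : nat) (A : 'M[R]_n) (j : nat) : R :=
  nth 0 (eigenvalues A) j.

Definition gaussian_kernel_matrix (R : realType) (n d : nat)
    (x : 'I_n -> 'rV[R]_d) (eta : R) : 'M[R]_n :=
  \matrix_(i, j) expR (- eta * norm2 (x i - x j) ^+ 2).

Definition effective_dimension (R : realType) (n : nat) (A : 'M[R]_n)
    (tau : R) : R :=
  \sum_(j < n) lambda A j / (lambda A j + tau * n%:R).

(* [r] is the radius of a ball around the origin containing the points. *)
Definition approximation_rank (R : realType) (n d : nat)
    (x : 'I_n -> 'rV[R]_d) (eta r eps : R) : R :=
  effective_dimension (gaussian_kernel_matrix x eta)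
    (eps / (2 * n%:R) * expR (- 4 * eta * r ^+ 2)).

(* Main.v *)
Require Import Defs.
From mathcomp Require Import all_boot all_order all_algebra.
From mathcomp Require Import complex polyrcf lra ring.
From mathcomp Require Import all_classical all_reals all_analysis.

Set Implicit Arguments.
Unset Strict Implicit.
Unset Printing Implicit Defensive.

Import Order.TTheory GRing.Theory Num.Theory.
Import numFieldNormedType.Exports.
Local Open Scope ring_scope.
Local Open Scope sesquilinear_scope.
Local Open Scope complex_scope.

(* Expanding exp(2 eta <x_i, x_j>) in its Taylor series up to degree N splits
   the Gaussian kernel matrix as K = L + E, where L has rank at most the number
   C(d + N, d) of monomials of degree at most N and E is positive semidefinite.
   Computing the trace of K (K + mu)^-1 in an orthonormal eigenbasis of L gives
   d_eff <= rank L + tr E / mu.  For N about log (2n / eps) + 8 eta R^2 the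
   second term is at most 1, and C(d + N, d) <= (3 (d + N) / d)^d. *)

(** * Characteristic polynomials under conjugation, and diagonal matrices *)

Lemma char_poly_conj (F : fieldType) n (P A : 'M[F]_n) :
  P \in unitmx -> char_poly (invmx P *m A *m P) = char_poly A.
Proof.
move=> Pu; have invPu : invmx P *m P = 1%:M by rewrite mulVmx.
rewrite /char_poly.
have -> : char_poly_mx (invmx P *m A *m P) =
    map_mx polyC (invmx P) *m char_poly_mx A *m map_mx polyC P.
  rewrite /char_poly_mx mulmxBr mulmxBl -!map_mxM; congr (_ - _).
  by rewrite scalar_mxC -mulmxA -map_mxM invPu map_mx1 mulmx1.
by rewrite !det_mulmx mulrAC -det_mulmx -map_mxM invPu map_mx1 det1 mul1r.
Qed.

Lemma char_poly_diag (F : fieldType) n (d : 'rV[F]_n) :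
  char_poly (diag_mx d) = \prod_(i < n) ('X - (d 0 i)%:P).
Proof.
rewrite char_poly_trig ?diag_mx_is_trig//.
by apply: eq_bigr => i _; rewrite !mxE eqxx mulr1n.
Qed.

(** Selecting the nonzero diagonal entries by [A] and inverting them by [B] factors an identity
    matrix of size [#|S|] through [diag_mx d]. *)
Lemma card_diag_neq0_le_rank (F : fieldType) n (d : 'rV[F]_n) :
  (#|[pred k | d ord0 k != 0%R]| <= \rank (diag_mx d))%N.
Proof.
set S := [pred k | _].
pose f := @enum_val _ S.
pose A : 'M[F]_(#|S|, n) := \matrix_(i, j) (f i == j)%:R.
pose B : 'M[F]_(n, #|S|) := \matrix_(i, j) ((i == f j)%:R / d ord0 (f j)).
have ADB : A *m diag_mx d *m B = 1%:M.
  apply/matrixP => i j; rewrite mul_mx_diag !mxE (bigD1 (f i)) //= big1 => [|k kfi].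
    rewrite !mxE eqxx mul1r addr0.
    have [->|ij] := eqVneq i j.
      have fS : d ord0 (f j) != 0 by have := enum_valP j.
      by rewrite eqxx mul1r mulfV.
    by rewrite (inj_eq enum_val_inj) (negbTE ij) mul0r mulr0.
  by rewrite !mxE eq_sym (negbTE kfi) !mul0r.
rewrite -[leqLHS](mxrank1 F) -ADB.
by apply: (leq_trans (mxrankM_maxl _ _)); apply: mxrankM_maxr.
Qed.

(** * Spectral decomposition of real symmetric matrices *)

Section Eigenvalues.
Variables (R : realType) (n : nat).
Implicit Types A : 'M[R]_n.

Local Notation toC := (real_complex R).

Lemma eigenvalues_perm A (l : 'I_n -> R) :
  char_poly A = \prod_(i < n) ('X - (l i)%:P) ->
  perm_eq (eigenvalues A) [seq l i | i <- index_enum 'I_n].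
Proof.
move=> charA; rewrite /eigenvalues (permPl (permEl (perm_sort _ _))).
set p := char_poly A.
have mu_p x : mup x p = count_mem x [seq l i | i <- index_enum 'I_n].
  by rewrite -mu_prod_XsubC /p charA big_map.
have p0 : p != 0 by rewrite monic_neq0// char_poly_monic.
apply/allP => x _ /=; apply/eqP; rewrite -mu_p count_flatten -map_comp.
rewrite sumnE big_map.
(* Only the block of copies of [x] contributes to the count of [x]. As [rootsR] lists each root
   once, this block has [mup x p] copies if [x] is a root; otherwise it is absent and [mup x p] is
   0. *)
rewrite (eq_bigr (fun y => if y == x then mup x p else 0%N)); last first.
  by move=> y _; rewrite /= count_nseq /=; case: eqVneq => [->|]; rewrite ?mul1n.
rewrite -big_mkcond big_const_seq iter_addn_0.
rewrite count_uniq_mem ?uniq_roots//.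
have := roots_on_rootsR p0 x; rewrite in_itv /= => <-.
by have [|/mupNroot ->] := boolP (root p x); rewrite ?muln1 ?muln0.
Qed.

(** Over [R[i]] the matrix is hermitian, hence unitarily diagonalizable with real diagonal, so real
    parts provide [l]. The unitary basis itself stays complex. *)
Lemma symmetric_spectral A : A^T = A ->
  exists (U : 'M[R[i]]_n) (l : 'I_n -> R),
    [/\ U \is unitarymx,
        map_mx toC A = U^t* *m diag_mx (\row_i toC (l i)) *m U &
        perm_eq (eigenvalues A) [seq l i | i <- index_enum 'I_n]].
Proof.
move=> Asym; set B := map_mx toC A.
have Bherm : B \is hermsymmx.
  apply: realsym_hermsym.
    apply/is_hermitianmxP; rewrite expr0 scale1r; apply/matrixP => i j.
    by rewrite !mxE -[in LHS]Asym mxE.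
  by apply/mxOverP => i j; rewrite mxE; apply/complex_realP; exists (A i j).
have Bdiag := orthomx_spectralP (hermitian_normalmx Bherm).
have /mxOverP dreal := hermitian_spectral_diag_real Bherm.
have Uu := spectral_unitarymx B.
pose l i := complex.Re (spectral_diag B ord0 i).
have dE : spectral_diag B = \row_i toC (l i).
  by apply/rowP => i; rewrite mxE RRe_real.
exists (spectralmx B), l; split => //.
  by rewrite -dE -invmx_unitary.
(* The factorization of the real characteristic polynomial is checked over [R[i]], where conjugation
   by the unitary basis leaves it unchanged. *)
apply: eigenvalues_perm; apply: (map_poly_inj toC).
rewrite map_char_poly -/B Bdiag char_poly_conj ?spectral_unit// char_poly_diag.
rewrite rmorph_prod; apply: eq_bigr => i _.
by rewrite rmorphB /= map_polyX map_polyC /= dE mxE.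
Qed.

End Eigenvalues.

(** * Positive semidefinite forms evaluated on complex vectors *)

Definition psdmx (R : numDomainType) n (A : 'M[R]_n) :=
  forall v : 'rV[R]_n, 0 <= (v *m A *m v^T) ord0 ord0.

(* The cross terms cancel because [b B a^T] is the transpose of [a B b^T]. *)
Lemma mulmx_conj_rect (C : comNzRingType) n (i : C) (B : 'M[C]_n)
    (a b : 'rV[C]_n) :
  i ^+ 2 = -1 -> B^T = B ->
  (a + i *: b) *m B *m (a^T - i *: b^T) = a *m B *m a^T + b *m B *m b^T.
Proof.
move=> i2 Bsym.
have cross : b *m B *m a^T = a *m B *m b^T.
  have tr11 (M : 'M[C]_1) : M = M^T by apply/matrixP => k l; rewrite mxE !ord1.
  by rewrite [LHS]tr11 !trmx_mul trmxK Bsym mulmxA.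
rewrite !mulmxDl !mulmxBr -!scalemxAl -!scalemxAr scalerA cross -expr2 i2.
by rewrite scaleN1r opprK addrA subrK.
Qed.

(** With row [k] of [V] written as [a + i b], the entry is the sum of the real quadratic form at [a]
    and at [b]. *)
Lemma psdmx_complex (R : rcfType) m n (A : 'M[R]_n) (V : 'M[R[i]]_(m, n)) k :
  A^T = A -> psdmx A -> 0 <= (V *m map_mx (real_complex R) A *m V^t*) k k.
Proof.
move=> Asym Apsd; set B := map_mx _ A.
pose a := \row_j complex.Re (V k j); pose b := \row_j complex.Im (V k j).
pose aC := map_mx (real_complex R) a; pose bC := map_mx (real_complex R) b.
have rowV : row k V = aC + 'i *: bC.
  by apply/rowP => j; rewrite !mxE; exact: complexE.
have rowVc : (row k V)^t* = aC^T - 'i *: bC^T.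
  apply/colP => j; rewrite !mxE; case: (V k j) => x y /=.
  apply/eqP; rewrite eq_complex /=.
  by rewrite !(mul0r, mul1r, mulr0, add0r, addr0, oppr0, subr0)/= !eqxx.
have -> : (V *m B *m V^t*) k k = (row k V *m B *m (row k V)^t*) ord0 ord0.
  by rewrite -row_mul !mxE; apply: eq_bigr => j _; rewrite !mxE.
rewrite rowVc rowV mulmx_conj_rect ?sqrCi//; last by rewrite /B map_trmx Asym.
by rewrite mxE !map_trmx -!map_mxM ![map_mx _ _ _ _]mxE -rmorphD ler0c addr_ge0.
Qed.

(** * Unitary changes of basis and the regularized trace *)

Lemma unitary_conjK (C : numClosedFieldType) n (U D : 'M[C]_n) :
  U \is unitarymx -> U *m (U^t* *m D *m U) *m U^t* = D.
Proof.
move=> /unitarymxP UUt.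
by rewrite !mulmxA UUt mul1mx -mulmxA UUt mulmx1.
Qed.

Lemma conj_diag_mxE (C : numClosedFieldType) n (W : 'M[C]_n) (d : 'rV[C]_n) k :
  (W *m diag_mx d *m W^t*) k k = \sum_i d ord0 i * `|W k i| ^+ 2.
Proof.
rewrite mul_mx_diag mxE; apply: eq_bigr => i _.
by rewrite !mxE normCK mulrAC [RHS]mulrC.
Qed.

Lemma unitary_row_norm (C : numClosedFieldType) n (W : 'M[C]_n) k :
  W \is unitarymx -> \sum_i `|W k i| ^+ 2 = 1.
Proof.
move=> /unitarymxP /matrixP/(_ k k); rewrite !mxE eqxx mulr1n => <-.
by apply: eq_bigr => i _; rewrite !mxE normCK.
Qed.

Lemma unitary_col_norm (C : numClosedFieldType) n (W : 'M[C]_n) i :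
  W \is unitarymx -> \sum_k `|W k i| ^+ 2 = 1.
Proof.
rewrite -trmx_unitary => /(@unitary_row_norm _ _ _ i) <-.
by apply: eq_bigr => k _; rewrite mxE.
Qed.

(* In the basis [V], row [k] contributes at most 1 if [h k != 0]; if [h k = 0]
   then [K] and [K - L] have the same diagonal entry there, and the bound
   [l / (l + mu) <= l / mu] leaves [1 / mu] times that entry. *)
Lemma regularized_trace_le (C : numClosedFieldType) n (K L U V : 'M[C]_n)
    (l h : 'rV[C]_n) (mu : C) :
  U \is unitarymx -> K = U^t* *m diag_mx l *m U -> (forall i, 0 <= l ord0 i) ->
  V \is unitarymx -> L = V^t* *m diag_mx h *m V ->
  (forall k, 0 <= (V *m (K - L) *m V^t*) k k) -> 0 < mu ->
  \sum_i l ord0 i / (l ord0 i + mu) <= (\rank L)%:R + \tr (K - L) / mu.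
Proof.
move=> Uu KE l_ge0 Vu LE.
pose e k := (V *m (K - L) *m V^t*) k k; move=> e_psd mu0.
have e_ge0 k : 0 <= e k by exact: e_psd.
have VtV : V^t* *m V = 1%:M by rewrite -invmx_unitary// mulVmx// unitarymx_unit.
(* The numbers [|W k i| ^+ 2] have all row and column sums 1. The sum of [g i * |W k i| ^+ 2] over
   [i] is the diagonal entry [k] of K (K + mu)^-1 in the basis [V]. *)
pose W := V *m U^t*.
have Wu : W \is unitarymx by rewrite mul_unitarymx// trmxC_unitary.
have dV : V *m L *m V^t* = diag_mx h.
  by rewrite LE unitary_conjK.
have VKV k : \sum_i l ord0 i * `|W k i| ^+ 2 = (V *m K *m V^t*) k k.
  by rewrite -conj_diag_mxE KE /W trmx_mul map_mxM trmxCK !mulmxA.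
pose g i := l ord0 i / (l ord0 i + mu).
have lmu i : 0 < l ord0 i + mu by rewrite ltr_wpDl.
have q_le1 k : \sum_i g i * `|W k i| ^+ 2 <= 1.
  rewrite -(unitary_row_norm k Wu); apply: ler_sum => i _.
  by rewrite ler_piMl ?exprn_ge0// /g ler_pdivrMr// mul1r lerDl ltW.
have q_le k : h ord0 k = 0 -> \sum_i g i * `|W k i| ^+ 2 <= e k / mu.
  move=> hk; rewrite /e mulmxBr mulmxBl mxE -VKV dV !mxE hk mul0rn oppr0 addr0.
  rewrite mulr_suml; apply: ler_sum => i _.
  rewrite [leRHS]mulrAC ler_wpM2r ?exprn_ge0// /g ler_wpM2l// lef_pV2 ?posrE//.
  by rewrite lerDr.
have q_sum : \sum_i g i = \sum_k \sum_i g i * `|W k i| ^+ 2.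
  rewrite exchange_big; apply: eq_bigr => i _ /=.
  by rewrite -mulr_sumr unitary_col_norm// mulr1.
have tr_e : \sum_k e k = \tr (K - L).
  by rewrite -[LHS]/(\tr _) mxtrace_mulC mulmxA VtV mul1mx.
have rankL : (#|[pred k | h ord0 k != 0%R]| <= \rank L)%N.
  apply: (leq_trans (card_diag_neq0_le_rank h)); rewrite -dV.
  by apply: (leq_trans (mxrankM_maxl _ _)); apply: mxrankM_maxr.
rewrite q_sum -tr_e mulr_suml.
apply: (@le_trans _ _ (\sum_k ((h ord0 k != 0)%:R + e k / mu))).
  apply: ler_sum => k _; have [hk|hk] := eqVneq (h ord0 k) 0.
    by rewrite add0r q_le.
  by rewrite (le_trans (q_le1 k))// lerDl divr_ge0// ltW.
rewrite big_split lerD2r -natr_sum ler_nat; apply: leq_trans rankL.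
by rewrite -sum1_card [leqRHS]big_mkcond leq_sum// => k _; rewrite inE; case: eqP.
Qed.

(** The complex trace bound is applied to the images of [K] and [L]; [real_complex] preserves rank,
    trace and order. *)
Lemma effective_dimension_le_rank_trace (R : realType) n (K L : 'M[R]_n) (tau : R) :
  K^T = K -> psdmx K -> L^T = L -> psdmx (K - L) -> 0 < tau * n%:R ->
  effective_dimension K tau <= (\rank L)%:R + \tr (K - L) / (tau * n%:R).
Proof.
move=> Ksym Kpsd Lsym Epsd; rewrite /effective_dimension.
set mu := tau * n%:R => mu0.
have [U [l [Uu KE eigK]]] := symmetric_spectral Ksym.
have [V [h [Vu LE _]]] := symmetric_spectral Lsym.
have l_ge0 i : 0 <= l i.
  have := psdmx_complex U i Ksym Kpsd.
  by rewrite KE (unitary_conjK _ Uu) !mxE eqxx mulr1n ler0c.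
have -> : \sum_(j < n) lambda K j / (lambda K j + mu) = \sum_i l i / (l i + mu).
  (* The list has exactly [n] entries, so the default value 0 in [lambda] is never read. *)
  have szK : size (eigenvalues K) = n.
    by rewrite (perm_size eigK) -sum1_size big_map big_const_ord iter_addn_0 mul1n.
  rewrite -(big_map l predT (fun y => y / (y + mu))) -(perm_big _ eigK) /=.
  by rewrite (big_nth 0) szK big_mkord.
have := @regularized_trace_le _ _ _ _ U V _ _ (real_complex R mu) Uu KE _ Vu LE.
pose lC : 'rV[R[i]]_n := \row_i real_complex R (l i).
have -> : \sum_i lC ord0 i / (lC ord0 i + real_complex R mu)
    = real_complex R (\sum_i l i / (l i + mu)).
  rewrite rmorph_sum; apply: eq_bigr => i _.
  by rewrite mxE -rmorphD fmorph_div.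
rewrite -map_mxB mxrank_map.
have -> : \tr (map_mx (real_complex R) (K - L)) = real_complex R (\tr (K - L)).
  by rewrite /mxtrace rmorph_sum; apply: eq_bigr => i _; rewrite mxE.
rewrite -fmorph_div -(rmorph_nat (real_complex R)) -rmorphD lecR; apply.
- by move=> i; rewrite mxE ler0c.
- by move=> k; apply: psdmx_complex => //; rewrite linearB /= Ksym Lsym.
- by rewrite ltcR.
Qed.

(** * Rank of truncated power series in inner products *)

Definition dotr (F : comNzRingType) d (u v : 'rV[F]_d) : F :=
  \sum_(a < d) u ord0 a * v ord0 a.

Lemma dotr_exp (F : comNzRingType) d (u v : 'rV[F]_d) k :
  dotr u v ^+ k = \sum_(f : {ffun 'I_k -> 'I_d})
    (\prod_s u ord0 (f s)) * (\prod_s v ord0 (f s)).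
Proof.
rewrite -[in LHS](card_ord k) -prodr_const bigA_distr_bigA /=.
by apply: eq_bigr => f _; rewrite -big_split.
Qed.

Section Rank.
Variables (F : fieldType) (d N : nat).

Definition monomial (t : d.-tuple 'I_N.+1) (u : 'rV[F]_d) :=
  \prod_(a < d) u ord0 a ^+ tnth t a.

(** [f] is a word of length [k] in the coordinates, and the tuple is the exponent vector of the
    corresponding product. [inord] would turn a count above [N] into 0, whence the condition
    [k <= N] below. *)
Definition multidegree k (f : {ffun 'I_k -> 'I_d}) : d.-tuple 'I_N.+1 :=
  [tuple inord #|[pred s | f s == a]| | a < d].

Definition low_degrees := [set t : d.-tuple 'I_N.+1 | (\sum_(i <- t) i <= N)%N]%SET.

Lemma tnth_multidegree k (f : {ffun 'I_k -> 'I_d}) a : (k <= N)%N ->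
  tnth (multidegree f) a = #|[pred s | f s == a]| :> nat.
Proof.
move=> kN; rewrite tnth_mktuple inordK// ltnS (leq_trans _ kN)//.
by rewrite -[leqRHS]card_ord max_card.
Qed.

Lemma multidegree_low k (f : {ffun 'I_k -> 'I_d}) :
  (k <= N)%N -> multidegree f \in low_degrees.
Proof.
move=> kN; rewrite inE big_tuple.
rewrite (eq_bigr (fun a => #|[pred s | f s == a]|)) => [|a _]; last first.
  exact: tnth_multidegree.
rewrite (leq_trans _ kN)// -[leqRHS]card_ord -sum1_card.
rewrite (partition_big f predT)//= leq_sum// => a _.
by rewrite sum1_card.
Qed.

Lemma monomial_multidegree k (f : {ffun 'I_k -> 'I_d}) (u : 'rV[F]_d) :
  (k <= N)%N -> \prod_s u ord0 (f s) = monomial (multidegree f) u.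
Proof.
move=> kN; rewrite (partition_big f predT)//=; apply: eq_bigr => a _.
rewrite tnth_multidegree// (eq_bigr (fun=> u ord0 a)) => [|s /eqP -> //].
exact: prodr_const.
Qed.

(** Words with the same multidegree give the same monomial, so grouping them factors the matrix
    through a space indexed by [low_degrees], whose cardinality is the binomial coefficient. *)
Lemma rank_truncated_dot_series n (y : 'I_n -> 'rV[F]_d) (c : nat -> F)
    (w : 'I_n -> F) :
  (\rank (\matrix_(i, j) (w i * w j *
      \sum_(0 <= k < N.+1) c k * dotr (y i) (y j) ^+ k)%R) <= 'C(d + N, d))%N.
Proof.
rewrite -card_partial_ord_partitions -/low_degrees.
pose A := \matrix_(i < n, s < #|low_degrees|) (w i * monomial (enum_val s) (y i)).
pose B := \matrix_(s < #|low_degrees|, j < n) (w j *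
  \sum_(0 <= k < N.+1) c k * \sum_(f : {ffun 'I_k -> 'I_d} |
     multidegree f == enum_val s) monomial (enum_val s) (y j)).
rewrite (_ : \matrix_(_, _) _ = A *m B) ?mulmx_max_rank//.
apply/matrixP => i j; rewrite !mxE.
under [RHS]eq_bigr do rewrite !mxE.
rewrite -(big_enum_val (fun t => w i * monomial t (y i) * (w j *
  \sum_(0 <= k < N.+1) c k * \sum_(f : {ffun 'I_k -> 'I_d} |
     multidegree f == t) monomial t (y j)))) /=.
under [RHS]eq_bigr => t _ do rewrite mulrACA mulr_sumr.
rewrite -mulr_sumr exchange_big; congr (_ * _) => /=.
rewrite !big_nat; apply: eq_bigr => k /andP[_ kN].
rewrite dotr_exp (partition_big (@multidegree k) (mem low_degrees)) /=; last first.
  by move=> f _; exact: multidegree_low.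
rewrite mulr_sumr; apply: eq_bigr => t _.
rewrite [RHS]mulrCA; congr (_ * _); rewrite mulr_sumr; apply: eq_bigr => f /eqP <-.
by rewrite -!monomial_multidegree.
Qed.

End Rank.

Local Open Scope classical_set_scope.

(** * Taylor remainders of the exponential *)

Section ExpTail.
Variable R : realType.

Definition exp_tail m (x : R) := expR x - series (exp_coeff x) m.

Lemma cvg_exp_tail m (x : R) :
  (\sum_(m <= k < n) exp_coeff x k) @[n --> \oo] --> exp_tail m x.
Proof.
apply: (@cvg_trans _ ((series (exp_coeff x) n - series (exp_coeff x) m) @[n --> \oo])).
  apply: near_eq_cvg; near=> n; rewrite sub_series_geq//.
  by near: n; exists m.
by apply: cvgB; [exact: is_cvg_series_exp_coeff|exact: cvg_cst].
Unshelve. all: by end_near. Qed.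

(** Each index [k >= m] satisfies [s ^+ m <= s ^+ k], so the scaled tail at [x] is dominated
    termwise by the series at [s * x]; the terms of the latter below [m] are nonnegative. *)
Lemma exp_tail_le m (x s : R) : 0 <= x -> 1 <= s ->
  s ^+ m * exp_tail m x <= expR (s * x).
Proof.
move=> x0 s1; have s0 : 0 <= s := le_trans ler01 s1.
have : (s ^+ m * \sum_(m <= k < n) exp_coeff x k) @[n --> \oo] -->
    s ^+ m * exp_tail m x.
  by apply: cvgMl_tmp; exact: cvg_exp_tail.
move/ler_cvg_to; apply; first exact: is_cvg_series_exp_coeff.
near=> n.
have mn : (m <= n)%N by near: n; exists m.
rewrite /series /= (big_cat_nat (leq0n m) mn) //= -[leLHS]add0r mulr_sumr.
apply: lerD.
  by apply: sumr_ge0 => k _; apply: exp_coeff_ge0; exact: mulr_ge0.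
rewrite !big_nat; apply: ler_sum => k /andP[mk _].
rewrite /exp_coeff /= mulrA ler_wpM2r ?invr_ge0// exprMn ler_wpM2r ?exprn_ge0//.
by rewrite ler_weXn2l.
Unshelve. all: by end_near. Qed.

(** Expanding the power over words [f] turns the double sum into a sum of squares. *)
Lemma dot_exp_psd n d (y : 'I_n -> 'rV[R]_d) (w : 'I_n -> R) k :
  0 <= \sum_i \sum_j w i * w j * dotr (y i) (y j) ^+ k.
Proof.
pose g (f : {ffun 'I_k -> 'I_d}) i := w i * \prod_s y i ord0 (f s).
rewrite (_ : \sum_i _ = \sum_f (\sum_i g f i) ^+ 2).
  by apply: sumr_ge0 => f _; exact: sqr_ge0.
transitivity (\sum_i \sum_j \sum_f g f i * g f j).
  apply: eq_bigr => i _; apply: eq_bigr => j _.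
  by rewrite dotr_exp mulr_sumr; apply: eq_bigr => f _; rewrite mulrACA.
under eq_bigr do rewrite exchange_big.
rewrite exchange_big; apply: eq_bigr => f _ /=.
by rewrite expr2 mulr_suml; apply: eq_bigr => i _; rewrite mulr_sumr.
Qed.

(* Hadamard powers of a Gram matrix are positive semidefinite, and the tail is
   a limit of nonnegative combinations of them. *)
Lemma exp_tail_psd n d (y : 'I_n -> 'rV[R]_d) (w : 'I_n -> R) (c : R) m :
  0 <= c -> 0 <= \sum_i \sum_j w i * w j * exp_tail m (c * dotr (y i) (y j)).
Proof.
move=> c0.
have : (\sum_i \sum_j w i * w j *
    \sum_(m <= k < p) exp_coeff (c * dotr (y i) (y j)) k) @[p --> \oo] -->
    \sum_i \sum_j w i * w j * exp_tail m (c * dotr (y i) (y j)).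
  apply: cvg_big => [|i _]; first exact: add_continuous.
  apply: cvg_big => [|j _]; first exact: add_continuous.
  by apply: cvgMl_tmp; exact: cvg_exp_tail.
move/cvgr_to_ge; apply; near=> p.
under eq_bigr do under eq_bigr do rewrite mulr_sumr.
under eq_bigr do rewrite exchange_big.
rewrite exchange_big; apply: sumr_ge0 => k _ /=.
rewrite (_ : \sum_i _ = c ^+ k / k`!%:R *
    \sum_i \sum_j w i * w j * dotr (y i) (y j) ^+ k).
  by rewrite mulr_ge0 ?divr_ge0 ?exprn_ge0// dot_exp_psd.
rewrite mulr_sumr; apply: eq_bigr => i _.
rewrite mulr_sumr; apply: eq_bigr => j _.
rewrite /exp_coeff /= exprMn; ring.
Unshelve. all: by end_near. Qed.

(** * Numerical bounds on exponentials and binomial coefficients *)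

Lemma expR1_le3 : expR 1 <= 3 :> R.
Proof.
(* [exp (1/6) <= 1 / (1 - 1/6)], and [(6/5)^6 < 3]. *)
have h : expR (6^-1) <= 6 / 5 :> R.
  rewrite -[leLHS]invrK -expRN -[leRHS]invf_div lef_pV2 ?posrE ?expR_gt0//.
  by apply: le_trans (expR_ge1Dx _); lra.
rewrite -[1](@mulfV _ 6%:R)// expRM_natl.
by apply: le_trans (lerXn2r 6 _ _ h) _; rewrite ?nnegrE ?expR_ge0//; lra.
Qed.

Lemma expR_nat_le m : expR m%:R <= 3 ^+ m :> R.
Proof.
by rewrite -[m%:R]mulr1 expRM_natl lerXn2r ?nnegrE ?expR_ge0// expR1_le3.
Qed.

(** The falling factorial ['C(d + N, d) * d!] is at most [(d + N) ^ d], and keeping the single term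
    [d ^ d / d!] of the series of [expR d] gives [d ^ d <= 3 ^ d * d!]. *)
Lemma bin_le_pow (N d : nat) : (0 < d)%N ->
  'C(d + N, d)%:R <= (3 * (d + N)%:R / d%:R) ^+ d :> R.
Proof.
move=> d0.
have fd0 : 0 < d`!%:R :> R by rewrite ltr0n fact_gt0.
have dd : d%:R ^+ d <= 3 ^+ d * d`!%:R :> R.
  rewrite -ler_pdivrMr//; apply: le_trans (expR_nat_le d).
  have := @expR_ge1Dxn R d%:R d.-1 (ler0n _ _); rewrite prednK//.
  by apply: le_trans; rewrite lerDr.
rewrite exprMn exprVn ler_pdivlMr ?exprn_gt0 ?ltr0n//.
have ff : 'C(d + N, d)%:R * d`!%:R <= (d + N)%:R ^+ d :> R.
  rewrite -natrM bin_ffact -natrX ler_nat.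
  rewrite ffact_prod -[X in (_ <= _ ^ X)%N](card_ord d) -prod_nat_const.
  apply: leq_prod => i _; exact: leq_subr.
by rewrite (le_trans (ler_wpM2l _ dd))// mulrCA exprMn ler_wpM2l// exprn_ge0.
Qed.

End ExpTail.

(** * The Gaussian kernel matrix and its Taylor approximation *)

Lemma norm2_sqr (R : realType) d (u : 'rV[R]_d) : norm2 u ^+ 2 = dotr u u.
Proof.
rewrite /norm2 sqr_sqrtr; first by apply: eq_bigr => a _; rewrite expr2.
by apply: sumr_ge0 => a _; exact: sqr_ge0.
Qed.

Lemma dotrC (F : comNzRingType) d (u v : 'rV[F]_d) : dotr u v = dotr v u.
Proof. by apply: eq_bigr => a _; rewrite mulrC. Qed.

Lemma dotr_sub_sqr (F : comNzRingType) d (u v : 'rV[F]_d) :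
  dotr (u - v) (u - v) = dotr u u + dotr v v - 2 * dotr u v.
Proof.
rewrite /dotr mulr_sumr -sumrN -!big_split; apply: eq_bigr => a _ /=.
by rewrite !mxE; ring.
Qed.

Section GaussianKernel.
Variables (R : realType) (n d : nat) (x : 'I_n -> 'rV[R]_d) (eta : R).

Definition gaussian_weight i := expR (- eta * dotr (x i) (x i)).

(** [m] counts Taylor terms, so degrees stay below [m]; the value [N.+1] corresponds to degree at
    most [N]. *)
Definition taylor_kernel_matrix m : 'M[R]_n :=
  \matrix_(i, j) (gaussian_weight i * gaussian_weight j *
    series (exp_coeff (2 * eta * dotr (x i) (x j))) m).

Lemma gaussian_kernelE i j : gaussian_kernel_matrix x eta i j =
  gaussian_weight i * gaussian_weight j * expR (2 * eta * dotr (x i) (x j)).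
Proof.
rewrite mxE norm2_sqr dotr_sub_sqr -!expRD; congr expR; ring.
Qed.

Lemma gaussian_sub_taylorE m i j :
  (gaussian_kernel_matrix x eta - taylor_kernel_matrix m) i j =
  gaussian_weight i * gaussian_weight j *
    exp_tail m (2 * eta * dotr (x i) (x j)).
Proof. by rewrite mxE gaussian_kernelE !mxE -mulrBr. Qed.

Lemma gaussian_kernel_sym :
  (gaussian_kernel_matrix x eta)^T = gaussian_kernel_matrix x eta.
Proof.
apply/matrixP => i j; rewrite mxE !gaussian_kernelE dotrC.
by rewrite [gaussian_weight j * _]mulrC.
Qed.

Lemma taylor_kernel_sym m : (taylor_kernel_matrix m)^T = taylor_kernel_matrix m.
Proof.
by apply/matrixP => i j; rewrite !mxE dotrC [gaussian_weight j * _]mulrC.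
Qed.

Lemma gaussian_sub_taylor_psd m : 0 <= eta ->
  psdmx (gaussian_kernel_matrix x eta - taylor_kernel_matrix m).
Proof.
move=> eta0 v.
(* The Gaussian weights are absorbed into the test vector. *)
have := @exp_tail_psd R n d x (fun i => v ord0 i * gaussian_weight i) (2 * eta) m.
rewrite mulr_ge0// => /(_ isT); congr (_ <= _).
rewrite exchange_big mxE; apply: eq_bigr => j _.
rewrite !mxE mulr_suml; apply: eq_bigr => i _.
by rewrite gaussian_sub_taylorE; ring.
Qed.

(** This is the case [m = 0], where the Taylor polynomial is empty. *)
Lemma gaussian_kernel_psd : 0 <= eta -> psdmx (gaussian_kernel_matrix x eta).
Proof.
move=> /(gaussian_sub_taylor_psd 0); rewrite (_ : taylor_kernel_matrix 0 = 0) ?subr0//.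
by apply/matrixP => i j; rewrite !mxE /series /= big_geq// mulr0.
Qed.

Lemma rank_taylor_kernel N :
  (\rank (taylor_kernel_matrix N.+1) <= 'C(d + N, d))%N.
Proof.
have := rank_truncated_dot_series N x (fun k => (2 * eta) ^+ k / k`!%:R)
  gaussian_weight.
congr (\rank _ <= _)%N; apply/matrixP => i j; rewrite !mxE; congr (_ * _).
by apply: eq_bigr => k _; rewrite /exp_coeff /= [in RHS]exprMn mulrAC.
Qed.

Lemma gaussian_sub_taylor_diag_le m i (r : R) : 0 <= eta -> norm2 (x i) <= r ->
  3 ^+ m * (gaussian_kernel_matrix x eta - taylor_kernel_matrix m) i i
    <= expR (4 * (eta * r ^+ 2)).
Proof.
move=> eta0 xr; rewrite gaussian_sub_taylorE.
have t0 : 0 <= dotr (x i) (x i) by rewrite -norm2_sqr sqr_ge0.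
have tr : dotr (x i) (x i) <= r ^+ 2.
  by rewrite -norm2_sqr lerXn2r// nnegrE ?sqrtr_ge0// (le_trans _ xr)// sqrtr_ge0.
(* With [s = 3] the tail contributes exponent 6 and the two weights contribute -2, in units of
   [eta * dotr (x i) (x i)]; this leaves the 4 of the conclusion. *)
have := @exp_tail_le R m (2 * eta * dotr (x i) (x i)) 3.
rewrite !mulr_ge0// ler1n => /(_ isT isT) tail.
rewrite mulrCA; apply: (le_trans (ler_wpM2l _ tail)).
  by rewrite mulr_ge0// expR_ge0.
rewrite -!expRD ler_expR.
have : eta * dotr (x i) (x i) <= eta * r ^+ 2 by rewrite ler_wpM2l.
lra.
Qed.

End GaussianKernel.

(** * Choice of the Taylor degree and final estimate *)

Theorem corollary3 (R : realType) (n d : nat) (hn : (0 < n)%N) (hd : (0 < d)%N)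
    (eps eta r : R) (heps0 : 0 < eps) (heps1 : eps < 1)
    (heta : 0 < eta) (hr : 0 < r)
    (x : 'I_n -> 'rV[R]_d) (hx : forall i, norm2 (x i) <= r) :
  approximation_rank x eta r eps
    <= 3 * (6 + 53 / d%:R * eta * r ^+ 2
              + 3 / d%:R * ln (2 * n%:R / eps)) ^+ d.
Proof.
rewrite /approximation_rank.
set K := gaussian_kernel_matrix x eta; set tau := _ * expR _; set l := ln _.
(* [N.+1] exceeds [l + 8 a], so [3 ^+ N.+1] absorbs both the factor
   [expR (4 a)] of the Taylor remainder and [tau^-1 = expR (l + 4 a)]. *)
pose a := eta * r ^+ 2; pose N := Num.truncn (l + 8 * a).
have n0 : 0 < n%:R :> R by rewrite ltr0n.
have d0 : 0 < d%:R :> R by rewrite ltr0n.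
have a0 : 0 <= a by rewrite mulr_ge0 ?sqr_ge0// ltW.
have q0 : 0 < 2 * n%:R / eps by rewrite divr_gt0// mulr_gt0.
have l0 : 0 <= l.
  rewrite ln_ge0// ler_pdivlMr// mul1r (le_trans (ltW heps1))//.
  by rewrite -natrM ler1n muln_gt0.
have la0 : 0 <= l + 8 * a by lra.
have N_le : N%:R <= l + 8 * a by rewrite truncn_le.
have N_gt : l + 8 * a < N.+1%:R by exact: truncnS_gt.
have tau0 : 0 < tau by rewrite mulr_gt0 ?expR_gt0// divr_gt0// mulr_gt0.
have mu0 : 0 < tau * n%:R by rewrite mulr_gt0.
have eta0 := ltW heta.
have tauE : expR (4 * a) = expR (l + 8 * a) * tau.
  rewrite /tau [RHS]mulrCA -expRD [RHS]mulrC.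
  rewrite (_ : l + 8 * a + _ = l + 4 * a); last by rewrite /a; ring.
  rewrite expRD /l lnK ?posrE//.
  by field; rewrite !gt_eqF.
have diag_le i : (K - taylor_kernel_matrix x eta N.+1) i i <= tau.
  have e0 : 0 < 3 ^+ N.+1 :> R by rewrite exprn_gt0.
  rewrite -(ler_pM2l e0).
  apply: le_trans (gaussian_sub_taylor_diag_le N.+1 eta0 (hx i)) _.
  rewrite -/a tauE ler_pM2r// (le_trans _ (expR_nat_le _ _))// ler_expR.
  exact: ltW.
have tr_le : \tr (K - taylor_kernel_matrix x eta N.+1) / (tau * n%:R) <= 1.
  rewrite ler_pdivrMr// mul1r /mxtrace.
  apply: le_trans (ler_sum _ (fun i _ => diag_le i)) _.
  by rewrite sumr_const card_ord mulr_natr.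
set B := _ + _ + _.
(* From [N <= l + 8 * a], the product [3 * (d + N)] is at most [3 * d + 24 * a + 3 * l], and the
   constants 6 and 53 dominate 3 and 24. *)
have NB : 3 * (d + N)%:R / d%:R <= B.
  rewrite ler_pdivrMr// natrD.
  rewrite (_ : B * d%:R = 6 * d%:R + 53 * a + 3 * l); first by lra.
  by rewrite /B /a; field; rewrite gt_eqF.
have B1 : 1 <= B.
  have h1 : 0 <= 53 / d%:R * eta * r ^+ 2.
    by rewrite !mulr_ge0 ?invr_ge0// ltW.
  have h2 : 0 <= 3 / d%:R * l by rewrite !mulr_ge0 ?invr_ge0.
  by rewrite /B; lra.
(* The rank accounts for [B ^+ d] and the trace for 1; since [1 <= B ^+ d], the factor 3 covers
   both. *)
apply: (@le_trans _ _ (B ^+ d + 1)).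
  apply: le_trans (effective_dimension_le_rank_trace (gaussian_kernel_sym x eta)
    (gaussian_kernel_psd x eta0) (taylor_kernel_sym x eta N.+1)
    (gaussian_sub_taylor_psd x N.+1 eta0) mu0) _.
  rewrite lerD// (@le_trans _ _ 'C(d + N, d)%:R)//.
    by rewrite ler_nat rank_taylor_kernel.
  apply: le_trans (bin_le_pow _ _ hd) _.
  by rewrite lerXn2r// nnegrE ?(le_trans _ B1)// divr_ge0// mulr_ge0.
have : 1 <= B ^+ d by rewrite exprn_ege1.
lra.
Qed.
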